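(* Let $G$ be an infinite ordered group and $T = \mathrm{Th}(G; +, <)$. Then $T$ is dp-small if and only if $G$ is abelian and divisible.
   Context: For a complete theory $T$ in language $L$ with monster model $\mathcal{U}$ ($\mathcal{U}_y$ the $|y|$-tuples from $\mathcal{U}$): a partial type $\pi(x)$ is dp-small if there do not exist $L(\mathcal{U})$-formulas $\varphi_i(x)$ ($i<\omega$), an $L$-formula $\psi(x;y)$ and $b_j\in\mathcal{U}_y$ ($j<\omega$) such that for all $i_0,j_0<\omega$ the type $\pi(x)\cup\{\varphi_{i_0}(x),\psi(x;b_{j_0})\}\cup\{\neg\varphi_i(x): i\ne i_0\}\cup\{\neg\psi(x;b_j): j\neq j_0\}$ is consistent. $T$ is dp-small if $x=x$ is dp-small for $x$ a single variable. *)

(* Defs.v *)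
From Stdlib Require Import List Arith.

Definition is_ordered_group {G : Type} (add : G -> G -> G) (zero : G)
  (neg : G -> G) (lt : G -> G -> Prop) : Prop :=
  (forall x y z, add x (add y z) = add (add x y) z) /\
  (forall x, add zero x = x /\ add x zero = x) /\
  (forall x, add (neg x) x = zero /\ add x (neg x) = zero) /\
  (forall x, ~ lt x x) /\
  (forall x y z, lt x y -> lt y z -> lt x z) /\
  (forall x y, lt x y \/ x = y \/ lt y x) /\
  (forall x y z, lt x y -> lt (add z x) (add z y)) /\
  (forall x y z, lt x y -> lt (add x z) (add y z)).

Definition infinite_type (G : Type) : Prop :=
  forall l : list G, exists x : G, ~ In x l.

Definition is_abelian {G : Type} (add : G -> G -> G) : Prop :=
  forall x y, add x y = add y x.

Fixpoint nmul {G : Type} (add : G -> G -> G) (zero : G) (n : nat) (y : G) : G :=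
  match n with
  | O => zero
  | S k => add y (nmul add zero k y)
  end.

Definition is_divisible {G : Type} (add : G -> G -> G) (zero : G) : Prop :=
  forall (x : G) (n : nat), 0 < n -> exists y : G, nmul add zero n y = x.

(** * Syntax: terms and formulas of L = {+, <} (with equality),
    with parameters from a type [A].  L-formulas are those with [A = Empty_set]. *)

Inductive term (A : Type) : Type :=
  | tvar : nat -> term A
  | tpar : A -> term A
  | tadd : term A -> term A -> term A.

Inductive form (A : Type) : Type :=
  | ffalse : form A
  | feq : term A -> term A -> form A
  | flt : term A -> term A -> form A
  | fimp : form A -> form A -> form A
  | fall : nat -> form A -> form A.

Arguments tvar {A}. Arguments tpar {A}. Arguments tadd {A}.
Arguments ffalse {A}. Arguments feq {A}. Arguments flt {A}.
Arguments fimp {A}. Arguments fall {A}.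

Definition upd {M : Type} (e : nat -> M) (n : nat) (m : M) : nat -> M :=
  fun k => if Nat.eqb k n then m else e k.

Fixpoint teval {A M : Type} (addM : M -> M -> M) (p : A -> M) (e : nat -> M)
  (t : term A) : M :=
  match t with
  | tvar n => e n
  | tpar a => p a
  | tadd t1 t2 => addM (teval addM p e t1) (teval addM p e t2)
  end.

Fixpoint sat {A M : Type} (addM : M -> M -> M) (ltM : M -> M -> Prop)
  (p : A -> M) (e : nat -> M) (f : form A) : Prop :=
  match f with
  | ffalse => False
  | feq t1 t2 => teval addM p e t1 = teval addM p e t2
  | flt t1 t2 => ltM (teval addM p e t1) (teval addM p e t2)
  | fimp f1 f2 => sat addM ltM p e f1 -> sat addM ltM p e f2
  | fall n f1 => forall m : M, sat addM ltM p (upd e n m) f1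
  end.

Definition no_params {M : Type} : Empty_set -> M := fun a => match a with end.

Definition models {M : Type} (addM : M -> M -> M) (ltM : M -> M -> Prop)
  (f : form Empty_set) : Prop :=
  forall e : nat -> M, sat addM ltM no_params e f.

(* M is a model of Th(G; +, <), i.e. M is elementarily equivalent to G.
   (Universal closures of L-formulas range over all L-sentences.) *)
Definition elem_equiv {G M : Type} (addG : G -> G -> G) (ltG : G -> G -> Prop)
  (addM : M -> M -> M) (ltM : M -> M -> Prop) : Prop :=
  forall f : form Empty_set, models addG ltG f <-> models addM ltM f.

(* phi(a) for an L(M)-formula phi in the single free variable x:
   every variable is interpreted as x. *)
Definition sat1 {M : Type} (addM : M -> M -> M) (ltM : M -> M -> Prop)
  (phi : form M) (a : M) : Prop :=
  sat addM ltM (fun m => m) (fun _ => a) phi.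

(* psi(a; b) for an L-formula psi(x; y): variable 0 is x, variable k+1 is y_k. *)
Definition sat2 {M : Type} (addM : M -> M -> M) (ltM : M -> M -> Prop)
  (psi : form Empty_set) (a : M) (b : nat -> M) : Prop :=
  sat addM ltM no_params (fun n => match n with O => a | S k => b k end) psi.

(* The partial type
     {phi_{i0}(x), psi(x; b_{j0})} u {~phi_i(x) : i <> i0} u {~psi(x; b_j) : j <> j0}
   over M is consistent (= finitely satisfiable in M). *)
Definition dp_type_consistent {M : Type} (addM : M -> M -> M) (ltM : M -> M -> Prop)
  (phi : nat -> form M) (psi : form Empty_set) (b : nat -> nat -> M)
  (i0 j0 : nat) : Prop :=
  forall (I J : list nat), exists a : M,
    sat1 addM ltM (phi i0) a /\ sat2 addM ltM psi a (b j0) /\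
    (forall i, In i I -> i <> i0 -> ~ sat1 addM ltM (phi i) a) /\
    (forall j, In j J -> j <> j0 -> ~ sat2 addM ltM psi a (b j)).

(* Th(G; +, <) is dp-small: the formula x = x (x a single variable) is dp-small,
   i.e. in no model of the theory is there a witnessing configuration
   (phi_i)_{i<omega}, psi(x;y), (b_j)_{j<omega}. *)
Definition dp_small_theory {G : Type} (addG : G -> G -> G) (ltG : G -> G -> Prop) : Prop :=
  ~ exists (M : Type) (addM : M -> M -> M) (ltM : M -> M -> Prop),
      elem_equiv addG ltG addM ltM /\
      exists (phi : nat -> form M) (psi : form Empty_set) (b : nat -> nat -> M),
        forall i0 j0 : nat, dp_type_consistent addM ltM phi psi b i0 j0.

(* Main.v *)
(** If [a] and [b] do not commute, then neither do any of their nonzero multiples,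
    because roots are unique in an ordered group.  Hence the right cosets of the
    centralizer of [b] through the multiples of [a], and the left cosets of the
    centralizer of [a] through the multiples of [b], form a configuration in [G].

    If [G] is abelian and [g > 0] is not divisible by [N], then the formulas
    "[x] is divisible by [N^i] but not by [N^(i+1)]" and the intervals
    [(j N^n g, (j+1) N^n g)] meet in [(N^i + j N^n) g] as soon as [n > i]; letting [n]
    tend to infinity along an ultrafilter gives a configuration in an ultrapower of [G].

    Conversely, in a divisible ordered abelian group the truth of a formula depends
    only on the signs of finitely many affine functions, so that the sets
    [psi(x;b)] have a bounded number of convex components, while each [phi_i(x)] is
    a finite union of convex sets; two applications of the pigeonhole principle
    exclude a configuration. *)
Require Import Defs.
From Stdlib Require Import List Arith Lia.
From Stdlib Require Import Classical ClassicalEpsilon FunctionalExtensionality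
  PropExtensionality ProofIrrelevance.
From mathcomp Require filter.

(** * Ordered groups *)

Section OrderedGroup.

Context {G : Type} {add : G -> G -> G} {zero : G} {neg : G -> G}
  {lt : G -> G -> Prop}.
Hypothesis HG : is_ordered_group add zero neg lt.

Local Infix "+" := add.
Local Infix "<" := lt.
Local Notation "- x" := (neg x).
Local Notation "n ** x" := (nmul add zero n x) (at level 40).

Lemma addA x y z : x + (y + z) = (x + y) + z.
Proof. apply HG. Qed.

Lemma add0l x : zero + x = x.
Proof. apply HG. Qed.

Lemma add0r x : x + zero = x.
Proof. apply HG. Qed.

Lemma addNl x : - x + x = zero.
Proof. apply HG. Qed.

Lemma addNr x : x + - x = zero.
Proof. apply HG. Qed.

Lemma lt_irrefl x : ~ x < x.
Proof. apply HG. Qed.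

Lemma lt_trans x y z : x < y -> y < z -> x < z.
Proof. apply HG. Qed.

Lemma lt_total x y : x < y \/ x = y \/ y < x.
Proof. apply HG. Qed.

Lemma add_lt_l z x y : x < y -> z + x < z + y.
Proof. apply HG. Qed.

Lemma add_lt_r z x y : x < y -> x + z < y + z.
Proof. apply HG. Qed.

Lemma lt_asym x y : x < y -> ~ y < x.
Proof. intros H1 H2; exact (lt_irrefl _ (lt_trans _ _ _ H1 H2)). Qed.

Lemma addKl x y : - x + (x + y) = y.
Proof. now rewrite addA, addNl, add0l. Qed.

Lemma addNKl x y : x + (- x + y) = y.
Proof. now rewrite addA, addNr, add0l. Qed.

Lemma addKr x y : (y + x) + - x = y.
Proof. now rewrite <- addA, addNr, add0r. Qed.

Lemma addNKr x y : (y + - x) + x = y.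
Proof. now rewrite <- addA, addNl, add0r. Qed.

Lemma add_inj_l x y z : x + y = x + z -> y = z.
Proof. intros H; rewrite <- (addKl x y), H; apply addKl. Qed.

Lemma add_lt_r_iff z x y : x + z < y + z <-> x < y.
Proof.
  split; [|apply add_lt_r].
  intros H; apply (add_lt_r (- z)) in H; now rewrite !addKr in H.
Qed.

Lemma sub_pos x y : zero < y + - x <-> x < y.
Proof. now rewrite <- (add_lt_r_iff x zero), addNKr, add0l. Qed.

Lemma sub_neg x y : y + - x < zero <-> y < x.
Proof. now rewrite <- (add_lt_r_iff x _ zero), addNKr, add0l. Qed.

Lemma negK x : - - x = x.
Proof. apply (add_inj_l (- x)); now rewrite addNr, addNl. Qed.

Lemma neg_pos x : zero < - x <-> x < zero.
Proof. now rewrite <- (add_lt_r_iff x), add0l, addNl. Qed.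

Lemma neg_lt0 x : - x < zero <-> zero < x.
Proof. now rewrite <- neg_pos, negK. Qed.

Lemma nmul_lt n x y : (0 < n)%nat -> x < y -> n ** x < n ** y.
Proof.
  intros Hn Hxy; induction n as [|n IH]; [lia|].
  destruct n as [|n]; cbn [nmul] in *.
  - now rewrite !add0r.
  - apply lt_trans with (y + (x + n ** x)).
    + now apply add_lt_r.
    + apply add_lt_l, IH; lia.
Qed.

Lemma nmul_lt_iff n x y : (0 < n)%nat -> n ** x < n ** y <-> x < y.
Proof.
  intros Hn; split; [|now apply nmul_lt].
  intros H; destruct (lt_total x y) as [?|[->|Hyx]]; trivial.
  - now apply lt_irrefl in H.
  - apply (nmul_lt n) in Hyx; trivial; now apply lt_asym in H.
Qed.

Lemma nmul_inj n x y : (0 < n)%nat -> n ** x = n ** y -> x = y.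
Proof.
  intros Hn H; destruct (lt_total x y) as [Hxy|[?|Hxy]]; trivial;
    apply (nmul_lt n) in Hxy; trivial; rewrite H in Hxy; now apply lt_irrefl in Hxy.
Qed.

Lemma nmul_add n m x : (n + m)%nat ** x = n ** x + m ** x.
Proof.
  induction n as [|n IH]; cbn; [now rewrite add0l|now rewrite IH, addA].
Qed.

Lemma nmul_nmul n m x : n ** (m ** x) = (n * m)%nat ** x.
Proof. induction n as [|n IH]; cbn; trivial; now rewrite nmul_add, IH. Qed.

Lemma nmul_zero n : n ** zero = zero.
Proof. induction n as [|n IH]; cbn; trivial; now rewrite add0l. Qed.

Lemma nmul_lt_coef g n m : zero < g -> n ** g < m ** g <-> (n < m)%nat.
Proof.
  intros Hg.
  assert (Hlt : forall n m, (n < m)%nat -> n ** g < m ** g).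
  { clear n m; intros n m Hnm; replace m with (n + (m - n))%nat by lia.
    rewrite nmul_add, <- (add0r (n ** g)) at 1; apply add_lt_l.
    pose proof (nmul_lt (m - n) zero g) as H; rewrite nmul_zero in H.
    apply H; trivial; lia. }
  split; [|apply Hlt].
  intros H; destruct (Nat.lt_trichotomy n m) as [?|[->|Hmn]]; trivial.
  - now apply lt_irrefl in H.
  - apply Hlt in Hmn; now apply lt_asym in H.
Qed.

(** * Commutation of multiples *)

Definition commute (x y : G) : Prop := x + y = y + x.

Lemma commute_sym x y : commute x y -> commute y x.
Proof. unfold commute; congruence. Qed.

Lemma commute_add x y z : commute x z -> commute y z -> commute (x + y) z.
Proof.
  unfold commute; intros Hx Hy; now rewrite <- addA, Hy, addA, Hx, addA.
Qed.

Lemma commute_neg x z : commute x z -> commute (- x) z.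
Proof.
  unfold commute; intros H.
  apply (add_inj_l x); now rewrite addNKl, addA, H, addKr.
Qed.

Lemma commute_nmul n x z : commute x z -> commute (n ** x) z.
Proof.
  intros H; induction n as [|n IH]; cbn.
  - unfold commute; now rewrite add0l, add0r.
  - now apply commute_add.
Qed.

Lemma nmul_conj n x z : n ** ((z + x) + - z) = (z + n ** x) + - z.
Proof.
  induction n as [|n IH]; cbn.
  - now rewrite add0r, addNr.
  - now rewrite IH, !addA, addNKr.
Qed.

(* [n ** x] is also the [n]-th multiple of the conjugate of [x] by [z], and
   multiplication by [n] is injective. *)
Lemma commute_root n x z : (0 < n)%nat -> commute (n ** x) z -> commute x z.
Proof.
  unfold commute; intros Hn H.
  assert (E : (z + x) + - z = x).
  { apply (nmul_inj n); trivial; now rewrite nmul_conj, <- H, addKr. }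
  rewrite <- E at 1; now rewrite addNKr.
Qed.

(** The difference is [(n - m) ** x] or the inverse of [(m - n) ** x], so uniqueness of roots
    applies. *)
Lemma commute_sub_multiples n m x z :
  n <> m -> commute (n ** x + - (m ** x)) z -> commute x z.
Proof.
  intros Hnm H; destruct (Nat.lt_trichotomy n m) as [Hlt|[?|Hlt]]; [|easy|].
  - apply (commute_root (m - n)); [lia|].
    apply commute_neg in H.
    replace ((m - n) ** x) with (- (n ** x + - (m ** x))); trivial.
    apply (add_inj_l (n ** x + - (m ** x))).
    replace m with ((m - n) + n)%nat at 3 by lia.
    replace (n ** x + - ((m - n + n)%nat ** x) + (m - n) ** x)
      with (n ** x + - ((m - n + n)%nat ** x) + ((m - n + n)%nat ** x + - (n ** x))).
    + now rewrite addNr, addA, addNKr, addNr.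
    + now rewrite nmul_add, addKr.
  - apply (commute_root (n - m)); [lia|].
    replace n with ((n - m) + m)%nat in H by lia.
    now rewrite nmul_add, addKr in H.
Qed.

(* The configuration is found in [G] itself, at the points [j b + i a]: the right
   cosets [C(b) + i a] of the centralizer of [b] are pairwise distinct, and so are
   the left cosets [j b + C(a)]. *)
Lemma dp_small_abelian : dp_small_theory add lt -> is_abelian add.
Proof.
  intros Hdp a b; destruct (classic (commute a b)) as [|Hab]; trivial.
  exfalso; apply Hdp; exists G, add, lt; split; [easy|].
  exists (fun i => feq (tadd (tadd (tvar 0) (tpar (- (i ** a)))) (tpar b))
                       (tadd (tpar b) (tadd (tvar 0) (tpar (- (i ** a)))))).
  exists (feq (tadd (tadd (tvar 1) (tvar 0)) (tvar 2))
              (tadd (tvar 2) (tadd (tvar 1) (tvar 0)))).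
  (* [psi] has no parameters, so [a] enters through the tuple, next to [- (j ** b)]. *)
  exists (fun j k => match k with O => - (j ** b) | _ => a end).
  intros i0 j0 I J; exists (j0 ** b + i0 ** a); unfold sat1, sat2; cbn.
  assert (Hi : forall i, commute ((j0 ** b + i0 ** a) + - (i ** a)) b <-> i = i0).
  { intros i; split.
    - intros H; destruct (Nat.eq_dec i0 i) as [|Hne]; [easy|]; exfalso; apply Hab.
      apply (commute_sub_multiples i0 i); trivial.
      (* [j0 ** b] commutes with [b] and can be cancelled, which leaves [i0 ** a + - (i ** a)]. *)
      rewrite <- (addKl (j0 ** b) (_ + _)), (addA (j0 ** b)).
      apply commute_add; trivial; now apply commute_neg, commute_nmul.
    - intros ->; rewrite addKr; now apply commute_nmul. }
  assert (Hj : forall j, commute (- (j ** b) + (j0 ** b + i0 ** a)) a <-> j = j0).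
  { intros j; split.
    - intros H; destruct (Nat.eq_dec j0 j) as [|Hne]; [easy|]; exfalso; apply Hab.
      apply commute_sym, (commute_sub_multiples j0 j); trivial.
      replace (j0 ** b + - (j ** b)) with (- (j ** b) + j0 ** b).
      + rewrite <- (addKr (i0 ** a) (_ + _)), <- (addA _ _ (i0 ** a)).
        apply commute_add; trivial; now apply commute_neg, commute_nmul.
      + apply commute_neg, commute_nmul, commute_sym, commute_nmul; easy.
    - intros ->; rewrite addKl; now apply commute_nmul. }
  split; [now apply Hi|split; [now apply Hj|]].
  split; intros k _ Hk E; [now apply Hi in E|now apply Hj in E].
Qed.

End OrderedGroup.

(** * Ultrapowers *)

(** An ultrafilter refining the filter of sets that contain a tail; its last clause is what lets the
    index [n] tend to infinity. *)
Lemma nonprincipal_ultrafilter : exists U : (nat -> Prop) -> Prop,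
  (forall A B : nat -> Prop, (forall n, A n -> B n) -> U A -> U B) /\
  (forall A B, U A -> U B -> U (fun n => A n /\ B n)) /\
  (forall A, U (fun n => ~ A n) <-> ~ U A) /\
  (forall k, U (fun n => k <= n)).
Proof.
  destruct (filter.ultraFilterLemma filter.eventually_filter) as [U [HU Hev]].
  assert (HP : filter.ProperFilter U) by apply HU.
  assert (H0 : ~ U (fun _ => False)) by apply HP.
  assert (HI : forall A B, U A -> U B -> U (fun n => A n /\ B n)) by apply HP.
  assert (HS : forall A B : nat -> Prop, (forall n, A n -> B n) -> U A -> U B) by apply HP.
  exists U; repeat split; trivial.
  - intros HnA HA; apply H0; refine (HS _ _ _ (HI _ _ HnA HA)); tauto.
  - intros HnA; destruct (filter.in_ultra_setVsetC A HU) as [HA|HA]; [easy|exact HA].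
  - intros k; apply Hev; exists k; [exact I|].
    intros n Hn; now apply (ssrbool.elimT ssrnat.leP).
Qed.

Lemma no_params_unique {M : Type} (p : Empty_set -> M) : p = no_params.
Proof. extensionality a; destruct a. Qed.

Section Ultrafilter.

Context (U : (nat -> Prop) -> Prop).
Hypothesis US : forall A B : nat -> Prop, (forall n, A n -> B n) -> U A -> U B.
Hypothesis UI : forall A B, U A -> U B -> U (fun n => A n /\ B n).
Hypothesis UC : forall A, U (fun n => ~ A n) <-> ~ U A.

Lemma ultra_iff (A B : nat -> Prop) : U (fun n => A n <-> B n) -> (U A <-> U B).
Proof.
  intros H; split; intros HA; refine (US _ _ _ (UI _ _ H HA)); tauto.
Qed.

Lemma ultra_all (A : nat -> Prop) : (forall n, A n) -> U A.
Proof.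
  intros H; destruct (classic (U A)) as [|HA]; trivial.
  apply UC in HA; refine (US _ _ _ HA); intros n Hn; now contradict Hn.
Qed.

Lemma ultra_inhabited (A : nat -> Prop) : U A -> exists n, A n.
Proof.
  intros HA; apply NNPP; intros H.
  assert (HF : U (fun n => ~ A n)) by (apply ultra_all; intros n Hn; apply H; eauto).
  now apply UC in HF.
Qed.

End Ultrafilter.

Section Ultrapower.

Context {G : Type} (add : G -> G -> G) (lt : G -> G -> Prop) (g0 : G).
Context (U : (nat -> Prop) -> Prop).
Hypothesis US : forall A B : nat -> Prop, (forall n, A n -> B n) -> U A -> U B.
Hypothesis UI : forall A B, U A -> U B -> U (fun n => A n /\ B n).
Hypothesis UC : forall A, U (fun n => ~ A n) <-> ~ U A.

Local Notation ultra_iff := (ultra_iff U US UI).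
Local Notation ultra_all := (ultra_all U US UC).
Local Notation ultra_inhabited := (ultra_inhabited U US UC).

Definition uequiv (f g : nat -> G) : Prop := U (fun n => f n = g n).

(** Equivalent sequences have equal predicates [uequiv], so the choice yields one canonical
    representative per class; these representatives serve as the quotient. *)
Definition urep (f : nat -> G) : nat -> G := epsilon (inhabits f) (uequiv f).

Lemma urep_equiv f : uequiv f (urep f).
Proof.
  unfold urep; apply epsilon_spec; exists f; now apply ultra_all.
Qed.

Lemma urep_eq f g : urep f = urep g <-> uequiv f g.
Proof.
  split.
  - intros H; pose proof (urep_equiv f) as Hf; pose proof (urep_equiv g) as Hg.
    rewrite H in Hf; refine (US _ _ _ (UI _ _ Hf Hg)); intros n [-> ->]; trivial.
  - intros H; unfold urep.
    replace (uequiv f) with (uequiv g).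
    + f_equal; apply proof_irrelevance.
    + extensionality h; apply propositional_extensionality; apply ultra_iff.
      refine (US _ _ _ H); intros n ->; tauto.
Qed.

Definition upow : Type := {f : nat -> G | exists g, f = urep g}.

Definition upi (f : nat -> G) : upow := exist _ (urep f) (ex_intro _ f eq_refl).

Lemma upi_eq f g : upi f = upi g <-> U (fun n => f n = g n).
Proof.
  rewrite <- (urep_eq f g); split; [intros H; now injection H|].
  intros H; now apply subset_eq_compat.
Qed.

Lemma upi_lift (m : upow) : upi (proj1_sig m) = m.
Proof.
  destruct m as [f [g ->]]; apply subset_eq_compat; cbn.
  symmetry; apply urep_eq, urep_equiv.
Qed.

Definition uadd (x y : upow) : upow :=
  upi (fun n => add (proj1_sig x n) (proj1_sig y n)).

Definition ult (x y : upow) : Prop :=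
  U (fun n => lt (proj1_sig x n) (proj1_sig y n)).

Lemma upi_add f g : uadd (upi f) (upi g) = upi (fun n => add (f n) (g n)).
Proof.
  apply upi_eq; refine (US _ _ _ (UI _ _ (urep_equiv f) (urep_equiv g))).
  cbn; intros n [-> ->]; trivial.
Qed.

Lemma upi_lt f g : ult (upi f) (upi g) <-> U (fun n => lt (f n) (g n)).
Proof.
  apply ultra_iff; refine (US _ _ _ (UI _ _ (urep_equiv f) (urep_equiv g))).
  cbn; intros n [-> ->]; tauto.
Qed.

Lemma teval_upi {A : Type} (p : A -> nat -> G) (e : nat -> nat -> G) (t : term A) :
  teval uadd (fun a => upi (p a)) (fun k => upi (e k)) t =
  upi (fun n => teval add (fun a => p a n) (fun k => e k n) t).
Proof.
  induction t as [k|a|t1 IH1 t2 IH2]; cbn; trivial.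
  now rewrite IH1, IH2, upi_add.
Qed.

(* Stated for arbitrary lifts of the environment: it has infinitely many values, so
   two lifts of it need not agree at any coordinate. *)
Theorem los {A : Type} (p : A -> nat -> G) (f : form A) : forall e : nat -> nat -> G,
  sat uadd ult (fun a => upi (p a)) (fun k => upi (e k)) f <->
  U (fun n => sat add lt (fun a => p a n) (fun k => e k n) f).
Proof.
  induction f as [|t1 t2|t1 t2|f1 IH1 f2 IH2|v f IH]; intros e; cbn.
  - split; [easy|]; intros H; now destruct (ultra_inhabited _ H).
  - rewrite !teval_upi; apply upi_eq.
  - rewrite !teval_upi; apply upi_lt.
  - rewrite IH1, IH2; split.
    + intros H; destruct (classic (U (fun n => sat add lt (fun a => p a n)
        (fun k => e k n) f1))) as [H1|H1].
      * refine (US _ _ _ (H H1)); tauto.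
      * apply UC in H1; refine (US _ _ _ H1); tauto.
    + intros H H1; refine (US _ _ _ (UI _ _ H H1)); tauto.
  - assert (Hupd : forall w : nat -> G,
      sat uadd ult (fun a => upi (p a)) (upd (fun k => upi (e k)) v (upi w)) f <->
      U (fun n => sat add lt (fun a => p a n) (upd (fun k => e k n) v (w n)) f)).
    { intros w; specialize (IH (upd e v w)).
      replace (upd (fun k => upi (e k)) v (upi w)) with (fun k => upi (upd e v w k)).
      - rewrite IH; apply ultra_iff, ultra_all; intros n.
        replace (upd (fun k => e k n) v (w n)) with (fun k => upd e v w k n); [tauto|].
        extensionality k; unfold upd; now destruct (Nat.eqb k v).
      - extensionality k; unfold upd; now destruct (Nat.eqb k v). }
    split.
    + intros H; apply NNPP; intros HU.
      (* Counterexamples are chosen at the coordinates where they exist; elsewhere the value is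
         arbitrary. *)
      set (Q := fun n m => ~ sat add lt (fun a => p a n) (upd (fun k => e k n) v m) f).
      specialize (H (upi (fun n => epsilon (inhabits g0) (Q n)))).
      apply Hupd in H; apply HU; refine (US _ _ _ H); intros n Hn m.
      apply NNPP; intros Hm; revert Hn.
      change (Q n (epsilon (inhabits g0) (Q n))); apply epsilon_spec; now exists m.
    + intros H m; rewrite <- (upi_lift m), Hupd; refine (US _ _ _ H); auto.
Qed.

Lemma elem_equiv_ultrapower : elem_equiv add lt uadd ult.
Proof.
  intros f.
  assert (Hlos : forall e, sat uadd ult no_params (fun k => upi (e k)) f <->
    U (fun n => sat add lt no_params (fun k => e k n) f)).
  { intros e; rewrite <- (no_params_unique (fun a => upi (match a with end))), los.
    apply ultra_iff, ultra_all; intros n; now rewrite (no_params_unique (fun a => _)). }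
  split; intros H e.
  - replace e with (fun k => upi (proj1_sig (e k))) by
      (extensionality k; apply upi_lift).
    apply Hlos, ultra_all; intros n; apply H.
  - specialize (H (fun k => upi (fun _ => e k))).
    now apply Hlos, ultra_inhabited in H as [n H].
Qed.

Lemma sat1_upi (phi : form upow) (a : nat -> G) :
  sat1 uadd ult phi (upi a) <->
  U (fun n => sat add lt (fun m => proj1_sig m n) (fun _ => a n) phi).
Proof.
  pose proof (los (fun m : upow => proj1_sig m) phi (fun _ => a)) as H.
  cbv beta in H.
  replace (fun m : upow => upi (proj1_sig m)) with (fun m : upow => m) in H; [exact H|].
  extensionality m; now rewrite upi_lift.
Qed.

Lemma sat2_upi (psi : form Empty_set) (a : nat -> G) (b : nat -> nat -> G) :
  sat2 uadd ult psi (upi a) (fun k => upi (b k)) <->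
  U (fun n => sat2 add lt psi (a n) (fun k => b k n)).
Proof.
  pose proof (los (fun c : Empty_set => match c with end) psi
    (fun k => match k with O => a | S k => b k end)) as H.
  cbv beta in H; rewrite (no_params_unique (fun c => upi _)) in H; unfold sat2.
  replace (fun k => match k with O => upi a | S k => upi (b k) end)
    with (fun k => upi (match k with O => a | S k => b k end)) by
    (extensionality k; now destruct k).
  rewrite H; apply ultra_iff, ultra_all; intros n.
  rewrite (no_params_unique (fun c => _)).
  replace (fun k => match k with O => a | S k => b k end n)
    with (fun k => match k with O => a n | S k => b k n end) by
    (extensionality k; now destruct k).
  tauto.
Qed.

End Ultrapower.

(** * Divisibility *)

(** The language has no constant for zero, so multiples start at one: [tmulS n t] denotes [n + 1]
    times [t]. *)
Fixpoint tmulS {A : Type} (n : nat) (t : term A) : term A :=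
  match n with
  | O => t
  | S k => tadd t (tmulS k t)
  end.

Definition fnot {A : Type} (f : form A) : form A := fimp f ffalse.
Definition fex {A : Type} (n : nat) (f : form A) : form A := fnot (fall n (fnot f)).

Lemma sat_fex {A M : Type} addM ltM (p : A -> M) e n f :
  sat addM ltM p e (fex n f) <-> exists m, sat addM ltM p (upd e n m) f.
Proof.
  cbn; split.
  - intros H; apply NNPP; intros Hn; apply H; intros m Hm; apply Hn; eauto.
  - intros [m Hm] H; exact (H m Hm).
Qed.

Definition fmultiple {A : Type} (n : nat) : form A :=
  fex 1 (feq (tmulS (pred n) (tvar 1)) (tvar 0)).

Section Divisibility.

Context {G : Type} {add : G -> G -> G} {zero : G} {neg : G -> G}
  {lt : G -> G -> Prop}.
Hypothesis HG : is_ordered_group add zero neg lt.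

Local Infix "+" := add.
Local Infix "<" := lt.
Local Notation "- x" := (neg x).
Local Notation "n ** x" := (nmul add zero n x) (at level 40).

Lemma teval_tmulS {A : Type} (p : A -> G) e n t :
  teval add p e (tmulS n t) = S n ** teval add p e t.
Proof.
  induction n as [|n IH]; cbn; [now rewrite (add0r HG)|].
  now rewrite IH.
Qed.

Lemma sat_fmultiple {A : Type} (p : A -> G) e n : n <> O ->
  sat add lt p e (fmultiple n) <-> exists y, n ** y = e O.
Proof.
  intros Hn; unfold fmultiple; rewrite sat_fex.
  cbn [sat]; split; intros [y Hy]; exists y; revert Hy; rewrite teval_tmulS;
    replace (S (pred n)) with n by lia; trivial.
Qed.

Hypothesis Hab : is_abelian add.

Lemma nmul_addr n x y : n ** (x + y) = n ** x + n ** y.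
Proof.
  induction n as [|n IH]; cbn; [now rewrite (add0l HG)|].
  rewrite IH, !(addA HG); f_equal; rewrite <- !(addA HG); f_equal; apply Hab.
Qed.

Lemma nmul_neg n x : n ** (- x) = - (n ** x).
Proof.
  apply (add_inj_l HG (n ** x)).
  now rewrite <- nmul_addr, !(addNr HG), nmul_zero by exact HG.
Qed.

(* In terms of powers of [N]: [N^i + j N^n] has [N]-adic valuation [i] for [i < n]. *)
Lemma multiple_power_iff N g i i' j n : (1 < N)%nat -> (i < n)%nat ->
  (~ exists y, N ** y = g) ->
  (exists y, N ^ i' ** y = (N ^ i + j * N ^ n)%nat ** g) <-> (i' <= i)%nat.
Proof.
  intros HN Hi Hg.
  assert (Hpow : forall k, (0 < N ^ k)%nat)
    by (intros k; apply Nat.neq_0_lt_0, Nat.pow_nonzero; lia).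
  split.
  - intros [y Hy]; destruct (Nat.le_gt_cases i' i) as [|Hlt]; trivial.
    exfalso; apply Hg.
    replace i' with (i + S (i' - S i))%nat in Hy by lia.
    replace n with (i + S (n - S i))%nat in Hy by lia.
    revert Hy; generalize (i' - S i)%nat, (n - S i)%nat; intros k l.
    rewrite !Nat.pow_add_r, !Nat.pow_succ_r'.
    replace (N ^ i + j * (N ^ i * (N * N ^ l)))%nat
      with (N ^ i * (1 + N * (j * N ^ l)))%nat by ring.
    rewrite <- !(nmul_nmul HG); intros Hy.
    apply (nmul_inj HG) in Hy; trivial.
    (* After cancelling [N ^ i] the equation reads [N ** (N ^ k ** y) = g + N ** ((j * N ^ l) **
       g)], so [g] is divisible by [N]. *)
    exists (N ^ k ** y + - ((j * N ^ l)%nat ** g)).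
    rewrite nmul_addr, nmul_neg, Hy, (nmul_add HG), (nmul_nmul HG); cbn.
    now rewrite (add0r HG), (addKr HG).
  - intros Hle; exists ((N ^ (i - i') + j * N ^ (n - i'))%nat ** g).
    rewrite (nmul_nmul HG); f_equal.
    replace i with (i' + (i - i'))%nat at 2 by lia.
    replace n with (i' + (n - i'))%nat at 2 by lia.
    rewrite !Nat.pow_add_r; ring.
Qed.

Lemma dp_small_divisible : dp_small_theory add lt -> is_divisible add zero.
Proof.
  intros Hdp x N HN0; apply NNPP; intros Hx; apply Hdp; clear Hdp.
  assert (HN : (1 < N)%nat).
  { destruct N as [|[|N]]; [lia| |lia].
    exfalso; apply Hx; exists x; cbn; apply (add0r HG). }
  assert (Hg : exists g, zero < g /\ ~ exists y, N ** y = g).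
  { destruct (lt_total HG zero x) as [H|[<-|H]].
    - now exists x.
    - exfalso; apply Hx; exists zero; now apply (nmul_zero HG).
    - exists (- x); split; [now apply (neg_pos HG)|].
      intros [y Hy]; apply Hx; exists (- y); now rewrite nmul_neg, Hy, (negK HG). }
  clear x Hx; destruct Hg as [g [Hg HNg]].
  destruct nonprincipal_ultrafilter as [U [US [UI [UC Uinf]]]].
  exists (@upow G U), (uadd add U), (ult lt U); split.
  { exact (elem_equiv_ultrapower add lt g U US UI UC). }
  (* Negated implications stand for conjunctions; [psi] is the interval [y_0 < x < y_1]. *)
  set (phi := fun i => @fnot (@upow G U) (fimp (fmultiple (N ^ i)) (fmultiple (N ^ S i)))).
  set (psi := @fnot Empty_set (fimp (flt (tvar 1) (tvar 0)) (fnot (flt (tvar 0) (tvar 2))))).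
  (* Index [k = 0] gives the left endpoint, every other index the right one; [n] is the coordinate
     in the ultrapower. *)
  set (b := fun j k n => match k with O => (j * N ^ n)%nat | _ => (S j * N ^ n)%nat end ** g).
  exists phi, psi, (fun j k => upi U (b j k)).
  intros i j I J; set (a := fun n => (N ^ i + j * N ^ n)%nat ** g).
  exists (upi U a).
  assert (Hphi : forall i', sat1 (uadd add U) (ult lt U) (phi i') (upi U a) <-> i' = i).
  { intros i'; rewrite (sat1_upi add lt g U US UI UC).
    rewrite (ultra_iff U US UI _ (fun _ => i' = i)).
    - split.
      + intros H; now apply (ultra_inhabited U US UC) in H as [_ H].
      + intros H; now apply (ultra_all U US UC).
    - refine (US _ _ _ (Uinf (S i))); intros n Hn; unfold phi.
      assert (HNk : forall k, N ^ k <> O) by (intros k; apply Nat.pow_nonzero; lia).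
      cbn [sat fnot]; rewrite !sat_fmultiple by trivial; unfold a.
      rewrite !multiple_power_iff by trivial; lia. }
  assert (Hpsi : forall j',
    sat2 (uadd add U) (ult lt U) psi (upi U a) (fun k => upi U (b j' k)) <-> j' = j).
  { intros j'; rewrite (sat2_upi add lt g U US UI UC).
    rewrite (ultra_iff U US UI _ (fun _ => j' = j)).
    - split.
      + intros H; now apply (ultra_inhabited U US UC) in H as [_ H].
      + intros H; now apply (ultra_all U US UC).
    - refine (US _ _ _ (Uinf (S i))); intros n Hn; unfold sat2, psi, a, b; cbn [sat fnot teval].
      rewrite !(nmul_lt_coef HG) by trivial.
      assert (0 < N ^ i)%nat by (apply Nat.neq_0_lt_0, Nat.pow_nonzero; lia).
      assert (N ^ i < N ^ n)%nat by (apply Nat.pow_lt_mono_r; lia).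
      (* As [0 < N ^ i < N ^ n], the coefficient lies strictly between [j * N ^ n] and
         [S j * N ^ n], and such intervals are disjoint for distinct [j]. *)
      destruct (Nat.lt_trichotomy j' j) as [Hj|[->|Hj]]; nia. }
  split; [now apply Hphi|split; [now apply Hpsi|]].
  split; intros k _ Hk E; [now apply Hphi in E|now apply Hpsi in E].
Qed.

End Divisibility.

(** * Divisible ordered abelian groups *)

Lemma list_comprehension {A : Type} (P : A -> Prop) (l : list A) :
  exists l', forall x, In x l' <-> In x l /\ P x.
Proof.
  induction l as [|a l [l' IH]].
  - exists nil; cbn; tauto.
  - destruct (classic (P a)) as [Ha|Ha].
    + exists (a :: l'); intros x; cbn; rewrite IH; intuition congruence.
    + exists l'; intros x; cbn; rewrite IH; intuition congruence.
Qed.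

Lemma pigeonhole n (f : nat -> nat) : (forall i, i <= n -> f i < n) ->
  exists i j, i < j <= n /\ f i = f j.
Proof.
  intros Hf; apply NNPP; intros H.
  assert (Hinj : NoDup (map f (seq 0 (S n)))).
  { apply NoDup_map_NoDup_ForallPairs; [|apply seq_NoDup].
    intros i j Hi Hj E; apply in_seq in Hi, Hj.
    destruct (Nat.lt_trichotomy i j) as [?|[?|?]]; trivial; exfalso; apply H;
      [exists i, j|exists j, i]; (split; [lia|easy]). }
  assert (Hincl : incl (map f (seq 0 (S n))) (seq 0 n)).
  { intros y Hy; apply in_map_iff in Hy as [i [<- Hi]]; apply in_seq in Hi.
    apply in_seq; specialize (Hf i); lia. }
  pose proof (NoDup_incl_length Hinj Hincl) as Hlen.
  rewrite length_map, !length_seq in Hlen; lia.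
Qed.

Section DivisibleOrderedAbelian.

Context {M : Type} {add : M -> M -> M} {zero : M} {neg : M -> M}
  {lt : M -> M -> Prop}.
Hypothesis HM : is_ordered_group add zero neg lt.
Hypothesis Hab : is_abelian add.
Hypothesis Hdiv : is_divisible add zero.
Hypothesis Hpos : exists h, lt zero h.

Local Infix "+" := add.
Local Infix "<" := lt.
Local Notation "- x" := (neg x).
Local Notation "n ** x" := (nmul add zero n x) (at level 40).

(** * Order patterns, density and back-and-forth *)

Definition same_order (x y x' y' : M) : Prop :=
  (x < y <-> x' < y') /\ (y < x <-> y' < x').

Definition same_sign (x x' : M) : Prop := same_order zero x zero x'.

Lemma same_sign_sub x y x' y' :
  same_sign (y + - x) (y' + - x') <-> same_order x y x' y'.
Proof.
  unfold same_sign, same_order; now rewrite !(sub_pos HM), !(sub_neg HM).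
Qed.

Lemma same_order_nmul k x y x' y' : (0 < k)%nat ->
  same_order (k ** x) (k ** y) (k ** x') (k ** y') <-> same_order x y x' y'.
Proof. intros Hk; unfold same_order; now rewrite !(nmul_lt_iff HM) by trivial. Qed.

Lemma addACA x y z w : (x + y) + (z + w) = (x + z) + (y + w).
Proof.
  rewrite <- !(addA HM); f_equal; rewrite !(addA HM); f_equal; apply Hab.
Qed.

Lemma neg_add x y : - (x + y) = - x + - y.
Proof.
  apply (add_inj_l HM (x + y)).
  now rewrite addACA, !(addNr HM), (add0l HM).
Qed.

Lemma midpoint x y : x < y -> exists z, x < z /\ z < y.
Proof.
  intros Hxy; destruct (Hdiv (x + y) 2) as [z Hz]; [lia|].
  exists z; rewrite <- (nmul_lt_iff HM 2 x), <- (nmul_lt_iff HM 2 z), Hz by lia.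
  cbn; rewrite !(add0r HM).
  split; [now apply (add_lt_l HM)|now apply (add_lt_r HM)].
Qed.

(** Halving makes the order dense, and a positive element rules out endpoints, which covers empty
    lists. *)
Lemma exists_between (L U : list M) :
  (forall l u, In l L -> In u U -> l < u) ->
  exists m, (forall l, In l L -> l < m) /\ (forall u, In u U -> m < u).
Proof.
  assert (Habove : forall x, exists y, x < y).
  { intros x; destruct Hpos as [h Hh]; exists (x + h).
    rewrite <- (add0r HM x) at 1; now apply (add_lt_l HM). }
  assert (Hbelow : forall x, exists y, y < x).
  { intros x; destruct Hpos as [h Hh]; exists (x + - h).
    rewrite <- (add0r HM x) at 2; apply (add_lt_l HM); now apply (neg_lt0 HM). }
  induction L as [|l L IH]; intros HLU.
  - clear HLU; induction U as [|u U [m [_ Hm]]].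
    + exists zero; split; intros ? [].
    + destruct (lt_total HM m u) as [H|H].
      * exists m; split; [intros ? []|]; intros v [<-|Hv]; auto.
      * destruct (Hbelow u) as [m' Hm']; exists m'; split; [intros ? []|].
        intros v [<-|Hv]; trivial; apply (lt_trans HM) with m; auto.
        destruct H as [->|H]; trivial; now apply (lt_trans HM) with u.
  - destruct IH as [m [HL HU]]; [cbn in *; auto|].
    destruct (lt_total HM l m) as [H|H].
    { exists m; split; trivial; intros l' [<-|Hl']; auto. }
    (* Now [m] is at most [l], so any point above [l] also stays above [L]. *)
    assert (Hl : exists m', l < m' /\ forall u, In u U -> m' < u).
    { assert (HlU : forall u, In u U -> l < u) by (intros; apply HLU; cbn; auto).
      clear HLU HU; induction U as [|u U IHU].
      - destruct (Habove l) as [m' Hm']; exists m'; split; [trivial|intros ? []].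
      - destruct IHU as [m' [Hm' HU']]; [cbn in *; auto|].
        destruct (lt_total HM m' u) as [Hu|Hu].
        + exists m'; split; trivial; intros v [<-|Hv]; auto.
        + destruct (midpoint l u) as [d [Hd1 Hd2]]; [apply HlU; cbn; auto|].
          exists d; split; trivial; intros v [<-|Hv]; trivial.
          apply (lt_trans HM) with m'; auto.
          destruct Hu as [->|Hu]; trivial; now apply (lt_trans HM) with u. }
    destruct Hl as [m' [Hm' HU']]; exists m'; split; trivial.
    intros l' [<-|Hl']; trivial.
    apply (lt_trans HM) with m; auto.
    destruct H as [<-|H]; trivial; now apply (lt_trans HM) with l.
Qed.

Definition divide (k : nat) (x : M) : M :=
  epsilon (inhabits zero) (fun y => k ** y = x).

Lemma nmul_divide k x : (0 < k)%nat -> k ** divide k x = x.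
Proof. intros Hk; unfold divide; apply epsilon_spec, Hdiv; trivial. Qed.

(* A triple [(k, u, u')] stands for the bound [u / k] and its counterpart [u' / k];
   for [k = 0] it carries the constraint on the sign of [u]. *)
Lemma back_and_forth (Q : list (nat * M * M)) :
  (forall k u u', In (k, u, u') Q -> same_sign u u') ->
  (forall k1 u1 u1' k2 u2 u2', In (k1, u1, u1') Q -> In (k2, u2, u2') Q ->
    same_order (k2 ** u1) (k1 ** u2) (k2 ** u1') (k1 ** u2')) ->
  forall m, exists m', forall k u u', In (k, u, u') Q ->
    same_order (k ** m) u (k ** m') u'.
Proof.
  intros H0 H1 m.
  (* If [m] attains a bound, [m'] has to be the corresponding root; otherwise the bounds below and
     above [m] leave an open interval for [m']. *)
  destruct (classic (exists k u u', In (k, u, u') Q /\ (0 < k)%nat /\ k ** m = u))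
    as [[k [u [u' [HQ [Hk Hm]]]]]|Hne].
  - exists (divide k u'); intros k2 u2 u2' HQ2.
    rewrite <- (same_order_nmul k), !(nmul_nmul HM), !(Nat.mul_comm k k2),
      <- !(nmul_nmul HM), Hm, nmul_divide by trivial; auto.
  - destruct (list_comprehension (fun q => (0 < fst (fst q))%nat /\
      snd (fst q) < fst (fst q) ** m) Q) as [L HL].
    destruct (list_comprehension (fun q => (0 < fst (fst q))%nat /\
      fst (fst q) ** m < snd (fst q)) Q) as [U HU].
    set (root := fun q : nat * M * M => divide (fst (fst q)) (snd q)).
    destruct (exists_between (map root L) (map root U)) as [m' [Hm1 Hm2]].
    { intros l v Hl Hv.
      apply in_map_iff in Hl as [[[k1 u1] u1'] [<- Hl]].
      apply in_map_iff in Hv as [[[k2 u2] u2'] [<- Hv]].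
      apply HL in Hl as [Hl1 [Hl2 Hl3]]; apply HU in Hv as [Hv1 [Hv2 Hv3]].
      unfold root; cbn in *.
      (* Clearing denominators gives the cross comparison in [H1], whose unprimed side holds because
         [m] lies between the two bounds. *)
      apply (nmul_lt_iff HM (k1 * k2)); [nia|].
      rewrite (Nat.mul_comm k1 k2) at 1.
      rewrite <- !(nmul_nmul HM), !nmul_divide by trivial.
      apply (H1 k1 u1 u1' k2 u2 u2'); trivial.
      apply (lt_trans HM) with (k2 ** (k1 ** m)).
      - now apply (nmul_lt HM).
      - rewrite (nmul_nmul HM), Nat.mul_comm, <- (nmul_nmul HM).
        now apply (nmul_lt HM). }
    exists m'; intros k u u' HQ.
    destruct k as [|k]; [exact (H0 _ _ _ HQ)|].
    assert (Hk : (0 < S k)%nat) by lia.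
    destruct (lt_total HM (S k ** m) u) as [H|[H|H]].
    + assert (H' : S k ** m' < u').
      { rewrite <- (nmul_divide (S k) u') by trivial; apply (nmul_lt HM); trivial.
        apply (Hm2 (root (S k, u, u'))), in_map, HU; auto. }
      split; split; intros Hlt; trivial; exfalso;
        [now apply (lt_asym HM) in H|now apply (lt_asym HM) in H'].
    + exfalso; apply Hne; eauto 6.
    + assert (H' : u' < S k ** m').
      { rewrite <- (nmul_divide (S k) u') by trivial; apply (nmul_lt HM); trivial.
        apply (Hm1 (root (S k, u, u'))), in_map, HL; auto. }
      split; split; intros Hlt; trivial; exfalso;
        [now apply (lt_asym HM) in H|now apply (lt_asym HM) in H'].
Qed.

(** * Affine functions and quantifier elimination *)

Inductive affine : ((nat -> M) -> M) -> Prop :=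
  | affine_const c : affine (fun _ => c)
  | affine_var n : affine (fun e => e n)
  | affine_add f g : affine f -> affine g -> affine (fun e => f e + g e)
  | affine_neg f : affine f -> affine (fun e => - f e).

Lemma affine_nmul k f : affine f -> affine (fun e => k ** f e).
Proof.
  intros Hf; induction k as [|k IH]; cbn; [apply affine_const|now apply affine_add].
Qed.

Lemma affine_upd f v c : affine f -> affine (fun e => f (upd e v c)).
Proof.
  induction 1 as [d|n|f g _ IHf _ IHg|f _ IHf].
  - apply affine_const.
  - unfold upd; destruct (Nat.eqb n v); [apply affine_const|apply affine_var].
  - now apply (affine_add _ _ IHf IHg).
  - now apply (affine_neg _ IHf).
Qed.

Lemma affine_teval {A : Type} (p : A -> M) (t : term A) :
  affine (fun e => teval add p e t).
Proof.
  induction t as [n|a|t1 IH1 t2 IH2]; cbn.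
  - apply affine_var.
  - apply affine_const.
  - now apply affine_add.
Qed.

(** One-parameter families of environments. [S] is a single variable for a quantifier and for
    [psi(x;b)], and consists of all variables for [phi], where each of them stands for [x]. *)
Definition varies_on (S : nat -> Prop) (E : M -> nat -> M) : Prop :=
  forall n a, (S n -> E a n = a) /\ (~ S n -> E a n = E zero n).

(** The slope, an integer written as [k - k'], counts signed occurrences of variables from [S]; only
    the constant term depends on [E]. *)
Lemma affine_slope S f : affine f -> exists k k', forall E, varies_on S E ->
  forall a, f (E a) = (k ** a + - (k' ** a)) + f (E zero).
Proof.
  induction 1 as [c|n|f g _ [k [k' IHf]] _ [l [l' IHg]]|f _ [k [k' IHf]]].
  - exists 0, 0; intros E _ a; cbn; now rewrite (addNr HM), (add0l HM).
  - destruct (classic (S n)) as [Hn|Hn].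
    + exists 1, 0; intros E HE a; cbn.
      rewrite (proj1 (HE n a)), (proj1 (HE n zero)) by trivial.
      rewrite !(add0r HM).
      rewrite <- (addKr HM zero a) at 1; now rewrite (add0r HM).
    + exists 0, 0; intros E HE a; cbn.
      rewrite (addNr HM), (add0l HM); now apply HE.
  - exists (k + l)%nat, (k' + l')%nat; intros E HE a.
    rewrite (IHf E HE a), (IHg E HE a), !(nmul_add HM), neg_add, addACA.
    f_equal; apply addACA.
  - exists k', k; intros E HE a.
    rewrite (IHf E HE a), !neg_add, (negK HM); f_equal; apply Hab.
Qed.

(** Solving for [a]: the sign is decided by comparing a multiple of [a] with plus or minus the
    constant term. Choosing [k] and [mu] before [E] gives uniformity in the parameters. *)
Lemma affine_bound S f : affine f -> exists k mu, affine mu /\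
  forall E E', varies_on S E -> varies_on S E' -> forall a a',
    same_order (k ** a) (mu (E zero)) (k ** a') (mu (E' zero)) ->
    same_sign (f (E a)) (f (E' a')).
Proof.
  intros Hf; destruct (affine_slope S f Hf) as [k [k' H]].
  destruct (Nat.le_gt_cases k' k) as [Hk|Hk].
  - exists (k - k'), (fun e => - f e); split; [now apply affine_neg|].
    assert (H' : forall E, varies_on S E -> forall a,
      f (E a) = (k - k') ** a + - - f (E zero)).
    { intros E HE a; rewrite (H E HE a), (negK HM); f_equal.
      replace k with ((k - k') + k')%nat at 1 by lia.
      now rewrite (nmul_add HM), (addKr HM). }
    intros E E' HE HE' a a' Ho; rewrite (H' E), (H' E') by trivial.
    rewrite same_sign_sub; unfold same_order in *; tauto.
  - exists (k' - k), f; split; trivial.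
    assert (H' : forall E, varies_on S E -> forall a,
      f (E a) = f (E zero) + - ((k' - k) ** a)).
    { intros E HE a; rewrite (H E HE a), Hab; f_equal.
      replace k' with ((k' - k) + k)%nat at 1 by lia.
      now rewrite (nmul_add HM), neg_add, Hab, (addNKr HM). }
    intros E E' HE HE' a a' Ho; rewrite (H' E), (H' E') by trivial.
    now rewrite same_sign_sub.
Qed.

Lemma affine_bounds S (Lam : list ((nat -> M) -> M)) :
  (forall f, In f Lam -> affine f) ->
  exists R : list (nat * ((nat -> M) -> M)),
    (forall k mu, In (k, mu) R -> affine mu) /\
    forall E E', varies_on S E -> varies_on S E' -> forall a a',
      (forall k mu, In (k, mu) R ->
        same_order (k ** a) (mu (E zero)) (k ** a') (mu (E' zero))) ->
      forall f, In f Lam -> same_sign (f (E a)) (f (E' a')).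
Proof.
  induction Lam as [|f Lam IH]; intros HLam.
  - exists nil; split; [intros ? ? []|intros E E' _ _ a a' _ ? []].
  - destruct IH as [R [HR1 HR2]]; [cbn in *; auto|].
    destruct (affine_bound S f) as [k [mu [Hmu Hf]]]; [apply HLam; cbn; auto|].
    exists ((k, mu) :: R); split.
    + intros k1 mu1 [E|H1]; [now injection E as <- <-|eauto].
    + intros E E' HE HE' a a' H g [<-|Hg].
      * apply Hf; trivial; apply H; cbn; auto.
      * apply HR2; trivial; intros; apply H; cbn; auto.
Qed.

Lemma varies_on_upd e v : varies_on (fun n => n = v) (upd e v).
Proof.
  intros n a; unfold upd; split.
  - intros ->; now rewrite Nat.eqb_refl.
  - intros Hn; apply Nat.eqb_neq in Hn; now rewrite Hn.
Qed.

(* Quantifier elimination in semantic form; the quantifier step adds the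
   Fourier-Motzkin combinations [k1 mu2 - k2 mu1]. *)
Lemma sat_determined_by_signs {A : Type} (p : A -> M) (phi : form A) :
  exists Lam : list ((nat -> M) -> M), (forall f, In f Lam -> affine f) /\
    forall e e', (forall f, In f Lam -> same_sign (f e) (f e')) ->
      (sat add lt p e phi <-> sat add lt p e' phi).
Proof.
  assert (Hsym : forall x x', same_sign x x' -> same_sign x' x)
    by (unfold same_sign, same_order; tauto).
  induction phi as [|t1 t2|t1 t2|f1 [L1 [HL1 IH1]] f2 [L2 [HL2 IH2]]|v f [L [HL IH]]].
  - exists nil; split; [intros ? []|easy].
  - exists ((fun e => teval add p e t2 + - teval add p e t1) :: nil); split.
    + intros f [<-|[]]; apply affine_add; [|apply affine_neg]; apply affine_teval.
    + intros e e' H; specialize (H _ (or_introl eq_refl)); apply (proj1 (same_sign_sub _ _ _ _)) in H.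
      cbn; unfold same_order in H; cbv beta in H.
      (* By totality, equality is the failure of both strict inequalities, so [same_order] controls
         it too. *)
      assert (Heq : forall x y, x = y <-> ~ x < y /\ ~ y < x).
      { intros x y; split.
        - intros ->; split; apply (lt_irrefl HM).
        - intros [Hn1 Hn2]; destruct (lt_total HM x y) as [?|[?|?]]; easy. }
      rewrite !Heq; tauto.
  - exists ((fun e => teval add p e t2 + - teval add p e t1) :: nil); split.
    + intros f [<-|[]]; apply affine_add; [|apply affine_neg]; apply affine_teval.
    + intros e e' H; specialize (H _ (or_introl eq_refl)); apply (proj1 (same_sign_sub _ _ _ _)) in H.
      cbn; unfold same_order in H; cbv beta in H; tauto.
  - exists (L1 ++ L2); split.
    + intros f Hf; apply in_app_or in Hf; destruct Hf; auto.
    + intros e e' H; cbn; rewrite (IH1 e e'), (IH2 e e'); [tauto|..];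
        intros f Hf; apply H, in_or_app; auto.
  - destruct (affine_bounds (fun n => n = v) L HL) as [R [HR1 HR2]].
    (* Setting [v] to zero removes the quantified variable from the bounds. *)
    set (at0 := fun (r : nat * ((nat -> M) -> M)) e => snd r (upd e v zero)).
    set (L' := map at0 R ++ map (fun rs e =>
      fst (fst rs) ** at0 (snd rs) e + - (fst (snd rs) ** at0 (fst rs) e)) (list_prod R R)).
    exists L'; split.
    + assert (Hat0 : forall r, In r R -> affine (at0 r))
        by (intros [k mu] Hr; apply affine_upd; eapply HR1, Hr).
      intros g Hg; apply in_app_or in Hg as [Hg|Hg]; apply in_map_iff in Hg.
      * destruct Hg as [r [<- Hr]]; auto.
      * destruct Hg as [[r s] [<- Hrs]]; apply in_prod_iff in Hrs as [Hr Hs].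
        apply affine_add; [|apply affine_neg]; apply affine_nmul; cbn; auto.
    + assert (Hhalf : forall e e', (forall g, In g L' -> same_sign (g e) (g e')) ->
        sat add lt p e (fall v f) -> sat add lt p e' (fall v f)).
      { intros e e' H Hall m'.
        (* The given value [m'] belongs to [e'], so the triples list the bounds at [e'] first and
           the matching point is found over [e]. *)
        destruct (back_and_forth (map (fun r => (fst r, at0 r e', at0 r e)) R))
          with (m := m') as [m Hm].
        - intros k u u' Hr; apply in_map_iff in Hr as [r [E Hr]].
          injection E as <- <- <-; apply Hsym, H, in_or_app; left; now apply in_map.
        - intros k1 u1 u1' k2 u2 u2' Hr Hs.
          apply in_map_iff in Hr as [r [E Hr]]; injection E as <- <- <-.
          apply in_map_iff in Hs as [s [E Hs]]; injection E as <- <- <-.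
          apply (proj1 (same_sign_sub _ _ _ _)), Hsym.
          apply (H (fun e => fst r ** at0 s e + - (fst s ** at0 r e))).
          apply in_or_app; right; apply in_map_iff; exists (r, s); split; trivial.
          now apply in_prod.
        - apply (IH (upd e v m)); [|apply Hall].
          apply HR2; [apply varies_on_upd|apply varies_on_upd|].
          intros k mu Hr.
          destruct (Hm k (at0 (k, mu) e') (at0 (k, mu) e)) as [Hm1 Hm2].
          + apply in_map_iff; exists (k, mu); auto.
          + split; symmetry; [exact Hm1|exact Hm2]. }
      intros e e' H; split; apply Hhalf; auto.
Qed.

(** The cuts are the quotients [mu / k]. They move with [E], but their number is the length of [R],
    which is fixed before [E]. *)
Lemma sat_determined_by_cuts {A : Type} (p : A -> M) (phi : form A) (S : nat -> Prop) :
  exists N, forall E, varies_on S E -> exists C : list M, length C <= N /\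
    forall a a', (forall c, In c C -> same_order a c a' c) ->
      (sat add lt p (E a) phi <-> sat add lt p (E a') phi).
Proof.
  destruct (sat_determined_by_signs p phi) as [L [HL Hphi]].
  destruct (affine_bounds S L HL) as [R [_ HR]].
  exists (length R); intros E HE.
  exists (map (fun r => divide (fst r) (snd r (E zero))) R); split.
  - now rewrite length_map.
  - intros a a' H; apply Hphi, HR; trivial.
    (* For [k = 0] zero is compared with the same value on both sides, so the arbitrary cut listed
       for it is harmless. *)
    intros k mu Hr; destruct k as [|k]; [easy|].
    rewrite <- (nmul_divide (Datatypes.S k) (mu (E zero))) by lia.
    apply same_order_nmul; [lia|]; apply H.
    apply in_map_iff; now exists (Datatypes.S k, mu).
Qed.

(** * Ranks relative to finitely many cuts *)

Definition position (c x : M) : nat :=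
  if excluded_middle_informative (x < c) then 0
  else if excluded_middle_informative (c < x) then 2 else 1.

(** A cut scores two when it lies below the point and one when it equals it, so that cuts and the
    gaps beside them get different ranks. *)
Fixpoint rank (C : list M) (x : M) : nat :=
  match C with
  | nil => 0
  | c :: C' => position c x + rank C' x
  end%nat.

Lemma rank_bound C x : rank C x <= 2 * length C.
Proof.
  induction C as [|c C IH]; cbn; [lia|].
  unfold position; destruct (excluded_middle_informative _); [lia|].
  destruct (excluded_middle_informative _); lia.
Qed.

Lemma position_mono c x y : x < y -> position c x <= position c y.
Proof.
  intros H; unfold position.
  destruct (excluded_middle_informative (y < c)) as [Hy|Hy].
  - destruct (excluded_middle_informative (x < c)) as [Hx|Hx]; [lia|].
    exfalso; apply Hx; now apply (lt_trans HM) with y.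
  - destruct (excluded_middle_informative (x < c)); [lia|].
    destruct (excluded_middle_informative (c < x)) as [Hx|Hx];
      destruct (excluded_middle_informative (c < y)) as [Hcy|Hcy]; try lia.
    exfalso; apply Hcy; now apply (lt_trans HM) with x.
Qed.

Lemma rank_mono C x y : ~ y < x -> rank C x <= rank C y.
Proof.
  intros H; destruct (lt_total HM x y) as [Hxy|[->|Hxy]]; [|lia|easy].
  induction C as [|c C IH]; cbn; [lia|].
  pose proof (position_mono c x y Hxy); lia.
Qed.

(** Each [position c] is monotone, so equal sums force equal summands. *)
Lemma rank_eq C x y : rank C x = rank C y ->
  forall c, In c C -> same_order x c y c.
Proof.
  intros H c Hc.
  assert (Hpos' : position c x = position c y).
  { assert (Hwlog : forall x y, x < y -> rank C x = rank C y -> position c x = position c y).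
    { clear x y H; intros x y Hxy H; induction C as [|d C IH]; [easy|]; cbn in H.
      pose proof (position_mono d x y Hxy).
      assert (Hr : rank C x <= rank C y) by (apply rank_mono, (lt_asym HM); trivial).
      destruct Hc as [->|Hc]; [lia|apply IH; trivial; lia]. }
    destruct (lt_total HM x y) as [Hxy|[->|Hxy]]; auto.
    symmetry; auto. }
  revert Hpos'; unfold position, same_order.
  assert (Has : ~ (c < x /\ x < c) /\ ~ (c < y /\ y < c))
    by (split; intros [H1 H2]; now apply (lt_asym HM) in H1).
  destruct (excluded_middle_informative (x < c)), (excluded_middle_informative (y < c)),
    (excluded_middle_informative (c < x)), (excluded_middle_informative (c < y));
    intros E; try discriminate E; tauto.
Qed.

(* Each [psi(x;b_j)] has boundedly many convex components, so one of its components
   meets two of the sets [phi_i] and hence crosses one of finitely many cuts; two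
   components crossing the same cut at indices [j <> j'] cannot be disjoint. *)
Lemma no_dp_configuration (phi : nat -> form M) (psi : form Empty_set)
  (b : nat -> nat -> M) : ~ forall i0 j0, dp_type_consistent add lt phi psi b i0 j0.
Proof.
  intros Hdp.
  destruct (sat_determined_by_cuts no_params psi (fun n => n = O)) as [N HN].
  (* At most [N] cuts give ranks from [0] to [2 * N], so the indices [0] to [nI] must repeat a rank;
     [nJ] plays the same role for [P]. *)
  set (nI := (2 * N + 1)%nat).
  assert (HP : forall n, exists P : list M, forall i, i <= n -> forall a a',
    (forall c, In c P -> same_order a c a' c) ->
    (sat1 add lt (phi i) a <-> sat1 add lt (phi i) a')).
  { assert (Hone : forall i, exists P : list M, forall a a',
      (forall c, In c P -> same_order a c a' c) ->
      (sat1 add lt (phi i) a <-> sat1 add lt (phi i) a')).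
    { intros i; destruct (sat_determined_by_cuts (fun m => m) (phi i) (fun _ => True))
        as [Ni HNi].
      destruct (HNi (fun a _ => a)) as [P [_ HP]]; [now split|]; now exists P. }
    induction n as [|n [P HP]].
    - destruct (Hone 0) as [P HP]; exists P; intros i Hi.
      now replace i with 0 by lia.
    - destruct (Hone (S n)) as [P' HP']; exists (P ++ P'); intros i Hi a a' H.
      destruct (Nat.eq_dec i (S n)) as [->|Hne].
      + apply HP'; intros; apply H, in_or_app; auto.
      + apply HP; [lia|]; intros; apply H, in_or_app; auto. }
  destruct (HP nI) as [P HPn]; clear HP.
  set (nJ := (2 * length P + 1)%nat).
  (* The segment from [y] to [z] stays inside [psi(x;b_j)] and crosses a cut of [P]; its left end
     avoids the other [psi(x;b_j')]. *)
  assert (Hcross : forall j, exists y z, (rank P y < rank P z)%nat /\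
    (forall w, ~ w < y -> ~ z < w -> sat2 add lt psi w (b j)) /\
    (forall j', j' <= nJ -> sat2 add lt psi y (b j') -> j' = j)).
  { intros j.
    destruct (choice (fun i a => sat1 add lt (phi i) a /\ sat2 add lt psi a (b j) /\
      (forall i', i' <= nI -> i' <> i -> ~ sat1 add lt (phi i') a) /\
      (forall j', j' <= nJ -> j' <> j -> ~ sat2 add lt psi a (b j')))) as [x Hx].
    { intros i; destruct (Hdp i j (seq 0 (S nI)) (seq 0 (S nJ))) as [a [H1 [H2 [H3 H4]]]].
      exists a; repeat split; trivial; intros k Hk.
      - apply H3, in_seq; lia.
      - apply H4, in_seq; lia. }
    destruct (HN (fun a n => match n with O => a | S k => b j k end)) as [C [HC HCpsi]].
    { intros [|n] a; split; easy. }
    destruct (pigeonhole nI (fun i => rank C (x i))) as [i1 [i2 [Hi Hrank]]].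
    { intros i _; pose proof (rank_bound C (x i)); lia. }
    (* Equal rank in [C] puts both points in one convex piece of [psi(x;b_j)], while [phi i]
       separates them and so makes their ranks in [P] differ. *)
    assert (Hwlog : forall i i', i <= nI -> i' <= nI -> i <> i' ->
      rank C (x i) = rank C (x i') -> x i < x i' ->
      exists y z, (rank P y < rank P z)%nat /\
      (forall w, ~ w < y -> ~ z < w -> sat2 add lt psi w (b j)) /\
      (forall j', j' <= nJ -> sat2 add lt psi y (b j') -> j' = j)).
    { intros i i' Hi1 Hi2 Hne Hr Hlt; exists (x i), (x i'); split; [|split].
      - assert (Hle : rank P (x i) <= rank P (x i'))
          by (apply rank_mono, (lt_asym HM); trivial).
        destruct (Nat.eq_dec (rank P (x i)) (rank P (x i'))) as [E|]; [|lia].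
        exfalso; apply (proj1 (proj2 (proj2 (Hx i'))) i Hi1 Hne).
        apply (HPn i Hi1 (x i)); [now apply rank_eq|apply Hx].
      - intros w Hw1 Hw2; apply (HCpsi (x i) w); [|apply Hx].
        apply rank_eq.
        assert (rank C (x i) <= rank C w) by now apply rank_mono.
        assert (rank C w <= rank C (x i')) by now apply rank_mono.
        lia.
      - intros j' Hj' Hpsi; destruct (Nat.eq_dec j' j) as [|Hne']; trivial.
        exfalso; now apply (proj2 (proj2 (proj2 (Hx i))) j'). }
    destruct (lt_total HM (x i1) (x i2)) as [H|[H|H]].
    - apply (Hwlog i1 i2); trivial; lia.
    - exfalso; apply (proj1 (proj2 (proj2 (Hx i1))) i2); [lia|lia|].
      rewrite H; apply Hx.
    - apply (Hwlog i2 i1); trivial; [lia|lia|lia|easy]. }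
  destruct (choice _ Hcross) as [y Hy]; destruct (choice _ Hy) as [z Hyz].
  destruct (pigeonhole nJ (fun j => rank P (y j))) as [j1 [j2 [Hj Hrank]]].
  { intros j _; pose proof (rank_bound P (y j)); lia. }
  (* If [y j'] were beyond [z j], monotonicity would bound [rank P (z j)] by the common rank of the
     left ends, against the crossing. So [y j'] lies in the segment of [j], contrary to the choice
     of [y j']. *)
  assert (Hwlog : forall j j', j <= nJ -> j' <= nJ -> j <> j' ->
    rank P (y j) = rank P (y j') -> ~ y j' < y j -> False).
  { intros j j' Hj1 Hj2 Hne Hr Hle; apply Hne.
    apply (proj2 (proj2 (Hyz j'))); trivial.
    apply (proj1 (proj2 (Hyz j))); trivial.
    intros Hlt; apply (lt_asym HM) in Hlt; apply (rank_mono P) in Hlt.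
    pose proof (proj1 (Hyz j)); lia. }
  destruct (classic (y j2 < y j1)) as [H|H].
  - apply (Hwlog j2 j1); [lia|lia|lia|easy|now apply (lt_asym HM)].
  - apply (Hwlog j1 j2); trivial; lia.
Qed.

End DivisibleOrderedAbelian.

(** * Transfer of the axioms to elementarily equivalent structures *)

Lemma elem_equiv_divisible_ordered_abelian {G M : Type}
  {add : G -> G -> G} {zero : G} {neg : G -> G} {lt : G -> G -> Prop}
  {addM : M -> M -> M} {ltM : M -> M -> Prop}
  (HG : is_ordered_group add zero neg lt) (Hnt : exists x, x <> zero)
  (Hab : is_abelian add) (Hdiv : is_divisible add zero)
  (Heq : elem_equiv add lt addM ltM) :
  exists zeroM negM, is_ordered_group addM zeroM negM ltM /\ is_abelian addM /\
    is_divisible addM zeroM /\ exists h, ltM zeroM h.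
Proof.
  (* An empty [M] has no environments and would satisfy [ffalse] vacuously, which [G] does not. *)
  assert (Hval : exists m : M, True).
  { apply NNPP; intros HM; destruct Hnt as [x _].
    refine (proj2 (Heq ffalse) _ (fun _ => x)); intros e; apply HM; now exists (e O). }
  destruct Hval as [m0 _].
  set (env := fun (x y z : M) k => match k with O => x | 1 => y | _ => z end).
  assert (HA : forall x y z, addM x (addM y z) = addM (addM x y) z).
  { intros x y z.
    refine (proj1 (Heq (feq (tadd (tvar 0) (tadd (tvar 1) (tvar 2)))
      (tadd (tadd (tvar 0) (tvar 1)) (tvar 2)))) _ (env x y z)).
    intros e; apply (addA HG). }
  assert (HC : is_abelian addM).
  { intros x y.
    refine (proj1 (Heq (feq (tadd (tvar 0) (tvar 1)) (tadd (tvar 1) (tvar 0)))) _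
      (env x y y)).
    intros e; apply Hab. }
  (* Zero and negation are not symbols of the language; they are recovered from existential
     statements, negation by choice. *)
  assert (HZ : exists z, forall x, addM z x = x).
  { refine (proj1 (sat_fex addM ltM no_params (fun _ => m0) O
      (fall 1 (feq (tadd (tvar 0) (tvar 1)) (tvar 1)))) _).
    apply (proj1 (Heq _)); intros e; apply sat_fex.
    exists zero; intros x; apply (add0l HG). }
  destruct HZ as [zeroM HZ].
  assert (HN : forall x, exists y, addM y x = zeroM).
  { intros x.
    (* The formula cannot name zero, so [(y + x) + z = z] is transferred for arbitrary [z] and read
       at [zeroM]. *)
    assert (H : exists y, addM (addM y x) zeroM = zeroM).
    { refine (proj1 (sat_fex addM ltM no_params (env x x zeroM) 1
        (feq (tadd (tadd (tvar 1) (tvar 0)) (tvar 2)) (tvar 2))) _).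
      apply (proj1 (Heq _)); intros e; apply sat_fex.
      exists (neg (e O)); cbn; now rewrite (addNl HG), (add0l HG). }
    destruct H as [y Hy]; exists y; now rewrite HC, HZ in Hy. }
  destruct (choice _ HN) as [negM HN'].
  assert (HM : is_ordered_group addM zeroM negM ltM).
  { assert (Hl : forall x y z, ltM x y -> ltM (addM z x) (addM z y)).
    { intros x y z.
      refine (proj1 (Heq (fimp (flt (tvar 0) (tvar 1))
        (flt (tadd (tvar 2) (tvar 0)) (tadd (tvar 2) (tvar 1))))) _ (env x y z)).
      intros e; exact (add_lt_l HG _ _ _). }
    split; [exact HA|split; [|split; [|split; [|split; [|split; [|split]]]]]].
    - intros x; split; [|rewrite HC]; apply HZ.
    - intros x; split; [|rewrite HC]; apply HN'.
    - intros x.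
      refine (proj1 (Heq (fimp (flt (tvar 0) (tvar 0)) ffalse)) _ (env x x x)).
      intros e; exact (lt_irrefl HG _).
    - intros x y z.
      refine (proj1 (Heq (fimp (flt (tvar 0) (tvar 1)) (fimp (flt (tvar 1) (tvar 2))
        (flt (tvar 0) (tvar 2))))) _ (env x y z)).
      intros e; exact (lt_trans HG _ _ _).
    - intros x y.
      assert (H : ~ ltM x y -> x <> y -> ltM y x).
      { refine (proj1 (Heq (fimp (fnot (flt (tvar 0) (tvar 1)))
          (fimp (fnot (feq (tvar 0) (tvar 1))) (flt (tvar 1) (tvar 0))))) _ (env x y y)).
        intros e; cbn; pose proof (lt_total HG (e 0) (e 1)); tauto. }
      tauto.
    - exact Hl.
    - intros x y z; rewrite !(HC _ z); apply Hl. }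
  exists zeroM, negM; split; [exact HM|split; [exact HC|split]].
  - intros x n Hn.
    apply (sat_fmultiple HM no_params (fun _ => x)); [lia|].
    apply (proj1 (Heq _)); intros e; apply (sat_fmultiple HG); [lia|auto].
  (* A positive element arises as a difference, so it suffices to transfer the existence of a pair
     [x < y]. *)
  - assert (H : exists x y, ltM x y).
    { assert (H : sat addM ltM no_params (fun _ => m0)
        (fex 0 (fex 1 (flt (tvar 0) (tvar 1))))).
      { apply (proj1 (Heq _)); intros e; apply sat_fex.
        destruct Hnt as [g Hg].
        destruct (lt_total HG zero g) as [H|[H|H]]; [|now destruct Hg|].
        - exists zero; apply sat_fex; now exists g.
        - exists g; apply sat_fex; now exists zero. }
      apply sat_fex in H as [x H]; apply sat_fex in H as [y H]; now exists x, y. }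
    destruct H as [x [y Hxy]]; exists (addM y (negM x)); now apply (sub_pos HM).
Qed.

Theorem theorem1p6 (G : Type) (add : G -> G -> G) (zero : G) (neg : G -> G)
  (lt : G -> G -> Prop)
  (HG : is_ordered_group add zero neg lt) (Hinf : infinite_type G) :
  dp_small_theory add lt <-> (is_abelian add /\ is_divisible add zero).
Proof.
  split.
  - intros Hdp; pose proof (dp_small_abelian HG Hdp) as Hab.
    split; [exact Hab|exact (dp_small_divisible HG Hab Hdp)].
  - intros [Hab Hdiv] [M [addM [ltM [Heq [phi [psi [b Hdp]]]]]]].
    assert (Hnt : exists x, x <> zero).
    { destruct (Hinf (zero :: nil)) as [x Hx]; exists x; intros ->; apply Hx; now left. }
    destruct (elem_equiv_divisible_ordered_abelian HG Hnt Hab Hdiv Heq)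
      as [zeroM [negM [HM [HabM [HdivM HposM]]]]].
    exact (no_dp_configuration HM HabM HdivM HposM phi psi b Hdp).
Qed.
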